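(* Let $K$ and $L$ be finite connected simplicial complexes. If the simplicial complexes $\mathfrak{M}(K)$ and $\mathfrak{M}(L)$ (the complexes of discrete Morse functions of $K$ and of $L$) are isomorphic, then $K$ and $L$ are isomorphic simplicial complexes.
   Context: Simplicial complexes are finite abstract simplicial complexes; their simplices are nonempty, and connected complexes are nonempty. Write $\sigma\prec\tau$ if $\sigma$ is an immediate face of $\tau$, i.e. a proper maximal face ($\sigma\subset\tau$, $\dim\tau=\dim\sigma+1$). A discrete Morse function on $K$ is a map $f$ from the set of simplices of $K$ to $\mathbb{R}$ such that for every $\sigma\in K$: (1) $|\{\tau\succ\sigma : f(\tau)\le f(\sigma)\}|\le 1$ and (2) $|\{\nu\prec\sigma : f(\nu)\ge f(\sigma)\}|\le 1$. A regular pair of $f$ is a pair $(\eta,\rho)$ with $\eta\prec\rho$ and $f(\eta)\ge f(\rho)$. Every simplex belongs to at most one regular pair of $f$. Two discrete Morse functions are equivalent if they have the same regular pairs, and equivalent functions are not distinguished. Write $f\lesssim g$ if every regular pair of $f$ is a regular pair of $g$. A primitive Morse function is one with exactly one regular pair; it is identified with that pair $(\sigma,\tau)$, $\sigma\prec\tau$ (every pair $\sigma\prec\tau$ arises this way). The complex of discrete Morse functions $\mathfrak{M}(K)$ is the simplicial complex whose vertices are the primitive Morse functions on $K$ (i.e. the pairs $(\sigma,\tau)$ with $\sigma\prec\tau$ in $K$) and in which a set $\{f_0,\dots,f_r\}$ of primitive Morse functions is an $r$-simplex iff it is exactly the set of regular pairs of some discrete Morse function on $K$. Equivalently, $\mathfrak{M}(K)$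 is the complex on the edges of the Hasse diagram of the face poset of $K$ (nonempty simplices only) whose simplices are the nonempty sets of edges that form acyclic matchings: no two edges share an endpoint, and the directed graph obtained from the Hasse diagram (edges directed from larger to smaller simplices) by reversing the edges in the set has no directed cycle. *)

(* Defs.v *)
From mathcomp Require Import all_boot all_order all_algebra.
From mathcomp Require Import boolp reals.
From mathcomp Require Import lra.

Set Implicit Arguments.
Unset Strict Implicit.
Unset Printing Implicit Defensive.

Import Order.TTheory GRing.Theory Num.Theory.
Local Open Scope ring_scope.

(* The vertex set is the whole type [vertex]. The complex without simplices
   (empty vertex type) is allowed: it occurs as the Morse complex of a point. *)
Record simplicial_complex := SimplicialComplex {
  vertex : finType;
  simplices : {set {set vertex}};
  simplices_neq0 : set0 \notin simplices;
  simplices_set1 : forall v : vertex, [set v] \in simplices;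
  simplices_sub : forall s t : {set vertex},
    t \in simplices -> s \subset t -> s != set0 -> s \in simplices }.

Definition isomorphic (K L : simplicial_complex) : Prop :=
  exists2 phi : vertex K -> vertex L, bijective phi &
    forall s : {set vertex K}, (phi @: s \in simplices L) = (s \in simplices K).

Definition adjacent (K : simplicial_complex) : rel (vertex K) :=
  fun u v => [set u; v] \in simplices K.

Definition connected_complex (K : simplicial_complex) : Prop :=
  (0 < #|vertex K|)%N /\ forall u v : vertex K, connect (@adjacent K) u v.

Definition simplex (K : simplicial_complex) : finType :=
  {s : {set vertex K} | s \in simplices K}.

(* The predecessor is harmless: simplices are nonempty. *)
Definition dim (K : simplicial_complex) (s : simplex K) : nat := #|val s|.-1.

Definition immediate_face (K : simplicial_complex) : rel (simplex K) :=
  fun s t => (val s \subset val t) && (dim t == (dim s).+1).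

Definition regular_pair (R : realType) (K : simplicial_complex)
    (f : simplex K -> R) : rel (simplex K) :=
  fun s t => immediate_face s t && (f t <= f s).

Definition discrete_Morse (R : realType) (K : simplicial_complex)
    (f : simplex K -> R) : Prop :=
  forall s : simplex K,
    (#|[set t | immediate_face s t & (f t <= f s)%R]| <= 1)%N /\
    (#|[set v | immediate_face v s & (f v >= f s)%R]| <= 1)%N.

(* A primitive Morse function, up to equivalence, is its unique regular pair. *)
Definition primitive (K : simplicial_complex) : finType :=
  {p : simplex K * simplex K | immediate_face p.1 p.2}.

Definition regular_pairs (R : realType) (K : simplicial_complex)
    (f : simplex K -> R) : {set primitive K} :=
  [set p | regular_pair f (val p).1 (val p).2].

Definition Morse_simplices (R : realType) (K : simplicial_complex) :
    {set {set primitive K}} :=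
  [set A | (A != set0) &&
    `[< exists2 f : simplex K -> R, discrete_Morse f & A = regular_pairs f >]].

Section MorseComplex.
Variables (R : realType) (K : simplicial_complex).
Implicit Types (s t u v : simplex K) (f g : simplex K -> R)
  (A B : {set primitive K}).

Lemma card_simplex_gt0 s : (0 < #|val s|)%N.
Proof.
rewrite card_gt0; apply: contraTneq (valP s) => ->.
exact: simplices_neq0.
Qed.

Lemma immediate_faceE s t :
  immediate_face s t = (val s \subset val t) && (#|val t| == #|val s|.+1).
Proof.
rewrite /immediate_face /dim prednK ?card_simplex_gt0 //.
by rewrite -[in RHS](prednK (card_simplex_gt0 t)) eqSS.
Qed.

Lemma inj2_pair (x y : simplex K * simplex K) :
  x.1 = y.1 -> x.2 = y.2 -> x = y.
Proof. by case: x y => [a b] [c d] /= -> ->. Qed.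

Lemma discrete_MorseP f :
  discrete_Morse f <->
  (forall s t t', regular_pair f s t -> regular_pair f s t' -> t = t') /\
  (forall s v v', regular_pair f v s -> regular_pair f v' s -> v = v').
Proof.
split=> [fM|[up dn] s].
  split=> s t t' st st'.
    by have [/card_le1_eqP H _] := fM s; apply/esym/H; rewrite inE.
  by have [_ /card_le1_eqP H] := fM s; apply/esym/H; rewrite inE.
split; apply/card_le1_eqP => t t'; rewrite !inE => st st'.
  exact: up st' st.
exact: dn st' st.
Qed.

Lemma immediate_face_diamond v s t : immediate_face v s -> immediate_face s t ->
  exists u, [/\ u != s, immediate_face v u & immediate_face u t].
Proof.
rewrite !immediate_faceE => /andP[vs /eqP cs] /andP[st /eqP ct].
have /cards1P[b Db] : #|val t :\: val s| == 1%N.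
  by rewrite cardsD (setIidPr st) ct subSnn.
have bt : b \in val t :\: val s by rewrite Db set11.
move: bt; rewrite inE => /andP[bs bt].
have bv : b \notin val v by apply: contra bs; apply: (subsetP vs).
have ut : b |: val v \subset val t.
  by rewrite subUset sub1set bt (subset_trans vs st).
have uK : b |: val v \in simplices K.
  apply: simplices_sub (valP t) ut _.
  by apply/set0Pn; exists b; rewrite setU11.
exists (exist (fun x => x \in simplices K) _ uK).
rewrite !immediate_faceE /= subsetUr ut cardsU1 bv ct cs.
rewrite add1n !eqxx; split=> //.
by apply: contraNneq bs => <-; rewrite setU11.
Qed.

Lemma discrete_Morse_up_down f v s t : discrete_Morse f ->
  regular_pair f v s -> regular_pair f s t -> False.
Proof.
move=> /discrete_MorseP[up dn] rvs rst.
have [/andP[vs fvs] /andP[st fst]] := (rvs, rst).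
have [u [us vu ut]] := immediate_face_diamond vs st.
have fvu : f v < f u.
  rewrite ltNge; apply: contraNN us => fuv; apply/eqP.
  by apply: up rvs; rewrite /regular_pair vu.
have fut : f u < f t.
  rewrite ltNge; apply: contraNN us => ftu; apply/eqP.
  by apply: dn rst; rewrite /regular_pair ut.
lra.
Qed.

Definition lower B s : bool := [exists p in B, (val p).1 == s].

Lemma lowerP B s : reflect (exists2 p, p \in B & (val p).1 = s) (lower B s).
Proof. by apply: (iffP exists_inP) => -[p pB /eqP]; exists p. Qed.

Lemma ltr_mulrnD (N a b : R) (m n : nat) :
  (m < n)%N -> `|a - b| < N -> N *+ m + a < N *+ n + b.
Proof.
move=> mn abN; have N0 : 0 <= N by apply: le_trans (ltW abN).
have := ler_wpMn2l N0 mn; rewrite mulrS.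
move: abN; rewrite ltr_norml => /andP[_].
by move: (N *+ m) (N *+ n) => x y; lra.
Qed.

Lemma Morse_extension B f :
  (forall p q, p \in B -> q \in B ->
     [/\ (val p).1 = (val q).1 -> p = q, (val p).2 = (val q).2 -> p = q
       & (val p).1 != (val q).2]) ->
  (forall p, p \in B -> f (val p).2 <= f (val p).1) ->
  (forall p q, p \in B -> q \notin B -> (val p).1 = (val q).1 ->
     f (val q).1 < f (val q).2) ->
  exists2 g : simplex K -> R, discrete_Morse g & B = regular_pairs g.
Proof.
move=> Bm Bf Nf.
pose N := 1 + \sum_s `|f s| *+ 2.
have fN s t : `|f s - f t| < N.
  have fb u : `|f u| <= \sum_s `|f s|.
    by rewrite (bigD1 u) //= lerDl sumr_ge0.
  have := fb s; have := fb t; have := ler_normB (f s) (f t).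
  by rewrite /N sumrMnl mulr2n; lra.
have N0 : 0 <= N by rewrite addr_ge0 // sumr_ge0 // => u _; rewrite mulrn_wge0.
move: N fN N0 => N fN N0.
pose h s : nat := (dim s + lower B s)%N.
pose g s : R := N *+ h s + f s.
have gB (p : primitive K) :
    (p \in B) = (g (val p).2 <= g (val p).1).
  have /andP[_ /eqP dp] := valP p.
  have [pB|pB] := boolP (p \in B); apply/esym.
    have lp : lower B (val p).1 by apply/lowerP; exists p.
    have lp' : lower B (val p).2 = false.
      case: lowerP => // -[q qB qp].
      by have [_ _] := Bm _ _ qB pB; rewrite qp eqxx.
    by rewrite /g /h lp lp' dp addn0 addn1 lerD2l Bf.
  apply/negbTE; rewrite -ltNge /g.
  have [lp|lp] := boolP (lower B (val p).1); last first.
    have hlt : (h (val p).1 < h (val p).2)%N.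
      by rewrite /h (negbTE lp) dp addn0 addSn ltnS leq_addr.
    exact: ltr_mulrnD hlt (fN _ _).
  have fp : f (val p).1 < f (val p).2.
    have /lowerP[q qB qp] := lp.
    exact: Nf qB pB qp.
  have hle : (h (val p).1 <= h (val p).2)%N.
    by rewrite /h lp dp addn1 leq_addr.
  exact: ler_ltD (ler_wpMn2l N0 hle) fp.
have Bg : B = regular_pairs g.
  by apply/setP => p; rewrite inE /regular_pair (valP p) gB.
exists g => //; apply/discrete_MorseP; split=> s t t' st st'.
- have [/andP[Fst _] /andP[Fst' _]] := (st, st').
  pose p : primitive K :=
    exist (fun x => immediate_face x.1 x.2) (s, t) Fst.
  pose p' : primitive K :=
    exist (fun x => immediate_face x.1 x.2) (s, t') Fst'.
  have pB : p \in B by rewrite Bg inE.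
  have pB' : p' \in B by rewrite Bg inE.
  by have [/(_ erefl)/(congr1 val)[]] := Bm _ _ pB pB'.
- have [/andP[Fst _] /andP[Fst' _]] := (st, st').
  pose p : primitive K :=
    exist (fun x => immediate_face x.1 x.2) (t, s) Fst.
  pose p' : primitive K :=
    exist (fun x => immediate_face x.1 x.2) (t', s) Fst'.
  have pB : p \in B by rewrite Bg inE.
  have pB' : p' \in B by rewrite Bg inE.
  by have [_ /(_ erefl)/(congr1 val)[]] := Bm _ _ pB pB'.
Qed.

Lemma discrete_Morse_sub f B : discrete_Morse f -> B \subset regular_pairs f ->
  exists2 g : simplex K -> R, discrete_Morse g & B = regular_pairs g.
Proof.
move=> fM /subsetP Bf; have [up dn] := (discrete_MorseP f).1 fM.
have rB p : p \in B -> regular_pair f (val p).1 (val p).2.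
  by move=> /Bf; rewrite inE.
apply: (@Morse_extension B f) => [p q pB qB|p /rB/andP[]//|p q pB qB pq].
  have [rp rq] := (rB _ pB, rB _ qB); split=> [pq|pq|].
  - apply: val_inj; apply: (inj2_pair pq).
    by apply: up rp _; rewrite pq.
  - apply: val_inj; apply: inj2_pair => //.
    by apply: dn rp _; rewrite pq.
  - apply/eqP => pq; move: rp; rewrite pq.
    exact: discrete_Morse_up_down rq.
rewrite ltNge; apply: contraNN qB => fq.
suff <- : p = q by [].
apply: val_inj; apply: inj2_pair => //.
by apply: up (rB _ pB) _; rewrite pq /regular_pair (valP q).
Qed.

Lemma primitive_Morse (p : primitive K) :
  exists2 f : simplex K -> R, discrete_Morse f & [set p] = regular_pairs f.
Proof.
pose f s : R := ((s != (val p).1) && (s != (val p).2))%:R.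
have /andP[_ /eqP dp] := valP p.
apply: (@Morse_extension _ f) => [q r|q|q r].
- move=> /set1P -> /set1P ->; split=> //.
  by apply: contra_eq_neq dp => ->; rewrite ltn_eqF.
- by move=> /set1P ->; rewrite /f !eqxx andbF.
- move=> /set1P ->; rewrite inE => rp pr; rewrite /f -pr eqxx /= ltr0n lt0b.
  have /andP[_ /eqP dr] := valP r.
  apply/andP; split.
    by apply: contra_eq_neq dr => ->; rewrite -pr ltn_eqF.
  apply: contra rp => /eqP rp; apply/eqP/val_inj.
  exact: inj2_pair.
Qed.

Lemma Morse_simplices_neq0 : set0 \notin Morse_simplices R K.
Proof. by rewrite inE eqxx. Qed.

Lemma Morse_simplices_set1 p : [set p] \in Morse_simplices R K.
Proof.
rewrite inE; apply/andP; split; first by apply/set0Pn; exists p; rewrite set11.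
exact/asboolP/primitive_Morse.
Qed.

Lemma Morse_simplices_sub A B :
  B \in Morse_simplices R K -> A \subset B -> A != set0 ->
  A \in Morse_simplices R K.
Proof.
rewrite !inE => /andP[_ /asboolP[f fM ->]] AB ->; apply/asboolP.
exact: discrete_Morse_sub fM AB.
Qed.

Definition Morse_complex : simplicial_complex :=
  SimplicialComplex Morse_simplices_neq0 Morse_simplices_set1
    Morse_simplices_sub.

End MorseComplex.

(* Main.v *)
(* Two primitive Morse functions span an edge of the Morse complex iff their
   pairs have no common simplex, since the Hasse diagram has no 4-cycle on two
   levels. So an isomorphism of Morse complexes is an isomorphism of the line
   graphs of the Hasse diagrams and, these being bipartite, comes from an
   isomorphism F of the undirected Hasse diagrams (Whitney).

   A Hasse diagram is an induced subgraph of the hypercube on the vertices, in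
   which two neighbours of a simplex have at most one further common neighbour;
   hence F maps squares to squares, and larger cubes to cubes. Three cases:
   - F maps some vertex v to a simplex of at least 3 elements.
     Cubes at v and at a neighbour of v show that v and its neighbours span the
     boundary of a simplex, and that no other vertex is adjacent to it. Thus
     K is the boundary of a simplex, and so is L, by symmetry.
   - Otherwise some F [set v] has 2 elements. Then K is a cycle, and F exchanges
     vertices and edges. Orient the cycle K and send each vertex to the image of
     its outgoing edge.
   - All F [set v] are singletons, and F preserves dimensions. *)

Require Import Defs.
From mathcomp Require Import all_boot all_order all_algebra.
From mathcomp Require Import boolp reals zify.

Set Implicit Arguments.
Unset Strict Implicit.
Unset Printing Implicit Defensive.

(* [Defs] is imported again because [dim] is shadowed by [vector]. *)
Import Order.TTheory GRing.Theory Num.Theory Defs.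

(** * Hasse diagrams inside the hypercube *)

(** The step from [x] in direction [a] of the hypercube of all subsets. As a symmetric difference it
    treats going up and going down alike. *)
Definition flip (V : finType) (a : V) (x : {set V}) : {set V} :=
  [set b | (b \in x) (+) (b == a)].

Section Flip.
Variable V : finType.
Implicit Types (a b c d : V) (x y : {set V}).

Lemma in_flip a x b : (b \in flip a x) = (b \in x) (+) (b == a).
Proof. by rewrite inE. Qed.

Lemma flipK a : involutive (flip a).
Proof. by move=> x; apply/setP => b; rewrite !inE addbK. Qed.

Lemma flipC a b x : flip a (flip b x) = flip b (flip a x).
Proof. by apply/setP => c; rewrite !inE addbAC. Qed.

Lemma flip_in a x : a \in x -> flip a x = x :\ a.
Proof.
move=> ax; apply/setP => b; rewrite !inE.
by case: eqVneq => [->|]; rewrite ?ax ?addbF.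
Qed.

Lemma flip_notin a x : a \notin x -> flip a x = a |: x.
Proof.
move=> /negbTE ax; apply/setP => b; rewrite !inE.
by case: eqVneq => [->|]; rewrite ?ax ?addbF.
Qed.

Lemma flip_inj2 a b x : flip a x = flip b x -> a = b.
Proof.
by move/setP/(_ a); rewrite !inE eqxx; case: (a \in x); case: eqVneq.
Qed.

Lemma flip_neq a x : flip a x <> x.
Proof. by move/setP/(_ a); rewrite !inE eqxx; case: (a \in x). Qed.

(** Two neighbours of [x] in the hypercube have exactly one common neighbour besides [x], reached by
    using both directions. *)
Lemma flip_square a b c d x : a != b -> flip c (flip a x) <> x ->
  flip c (flip a x) = flip d (flip b x) -> c = b.
Proof.
move=> ab cax /setP E.
have ca : c != a by apply: contra_notN cax => /eqP ->; rewrite flipK.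
move: (E c); rewrite !inE eqxx (negbTE ca).
have [//|cb] := eqVneq c b.
have [cd|cd] := eqVneq c d; last by case: (c \in x).
move: (E a); rewrite !inE eqxx (negbTE ab) -cd eq_sym (negbTE ca).
by case: (a \in x).
Qed.

End Flip.

(* [F] and [G] are junk outside the simplices of [K] and [L]. *)
Record hasse_iso (K L : simplicial_complex)
    (F : {set vertex K} -> {set vertex L})
    (G : {set vertex L} -> {set vertex K}) : Prop := HasseIso {
  hasse_in : forall x, x \in simplices K -> F x \in simplices L;
  hasse_in_inv : forall y, y \in simplices L -> G y \in simplices K;
  hasseK : {in simplices K, cancel F G};
  hasse_invK : {in simplices L, cancel G F};
  hasse_flip : forall x a, x \in simplices K -> flip a x \in simplices K ->
    exists b, F (flip a x) = flip b (F x);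
  hasse_flip_inv : forall y b, y \in simplices L -> flip b y \in simplices L ->
    exists a, G (flip b y) = flip a (G y) }.

Lemma hasse_iso_sym K L F G : @hasse_iso K L F G -> @hasse_iso L K G F.
Proof. by case. Qed.

Lemma simplex_neq0 (K : simplicial_complex) (x : {set vertex K}) :
  x \in simplices K -> x != set0.
Proof. by apply: contraTneq => ->; apply: simplices_neq0. Qed.

Lemma connected_closed (K : simplicial_complex) (S : {set vertex K}) u :
  connected_complex K -> u \in S ->
  (forall v w, v \in S -> v != w -> [set v; w] \in simplices K -> w \in S) ->
  S = setT.
Proof.
move=> [_ Kc] uS Scl.
have adjC : symmetric (@adjacent K) by move=> v w; rewrite /adjacent setUC.
have cl : closed (@adjacent K) S.
  apply: intro_closed; first exact: sym_connect_sym.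
  by move=> v w vw vS; have [<-//|ne] := eqVneq v w; apply: Scl ne vw.
apply/setP => w; rewrite inE; move: (closed_connect cl (Kc u w)).
by rewrite uS.
Qed.

Section HasseIso.
Variables (K L : simplicial_complex).
Variables (F : {set vertex K} -> {set vertex L}).
Variables (G : {set vertex L} -> {set vertex K}).
Hypothesis FG : hasse_iso F G.

Lemma hasse_inj : {in simplices K &, injective F}.
Proof. exact: can_in_inj (hasseK FG). Qed.

(** The image of the fourth corner is adjacent to the images of two corners and differs from [F x],
    so [flip_square] identifies it. *)
Lemma hasse_square a b c d x : a != b ->
  x \in simplices K -> flip a x \in simplices K -> flip b x \in simplices K ->
  F (flip a x) = flip c (F x) -> F (flip b x) = flip d (F x) ->
  flip a (flip b x) \in simplices K ->
  F (flip a (flip b x)) = flip c (flip d (F x)).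
Proof.
move=> ab xK axK bxK Fa Fb abxK.
have cd : d != c.
  apply: contra_neq ab => E; rewrite E -Fa in Fb.
  by move/hasse_inj: Fb => /(_ bxK axK)/flip_inj2.
have [e Ee] := hasse_flip FG bxK abxK.
have baxK : flip b (flip a x) \in simplices K by rewrite flipC.
have [f Ef] := hasse_flip FG axK baxK.
rewrite Ee Fb; congr (flip _ _).
apply: (@flip_square _ d c e f (F x)) => //.
  rewrite -Fb -Ee => /(hasse_inj abxK xK) => E; move: ab.
  have := congr1 (flip b) E; rewrite flipC flipK => /flip_inj2 ->.
  by rewrite eqxx.
by rewrite -Fb -Fa -Ee -Ef flipC.
Qed.

End HasseIso.

(** This is [hasse_square] applied to [G]. It produces new simplices of [K] from simplices of
    [L]. *)
Lemma hasse_square_inv K L F G (FG : @hasse_iso K L F G) a b c d x : c != d ->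
  x \in simplices K -> flip a x \in simplices K -> flip b x \in simplices K ->
  F (flip a x) = flip c (F x) -> F (flip b x) = flip d (F x) ->
  flip c (flip d (F x)) \in simplices L ->
  flip a (flip b x) \in simplices K /\
  F (flip a (flip b x)) = flip c (flip d (F x)).
Proof.
move=> cd xK axK bxK Fa Fb cdL.
have E : G (flip c (flip d (F x))) = flip a (flip b x).
  rewrite -[in RHS](hasseK FG xK).
  apply: (hasse_square (hasse_iso_sym FG)) => //.
  - exact: hasse_in FG _ xK.
  - by rewrite -Fa (hasse_in FG).
  - by rewrite -Fb (hasse_in FG).
  - by rewrite -Fa !(hasseK FG).
  - by rewrite -Fb !(hasseK FG).
rewrite -E; split; first exact: hasse_in_inv FG _ cdL.
exact: hasse_invK FG _ cdL.
Qed.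

(* Directions that go up at [x] and down at [F x] span a cube of [K], truncated
   only where the corresponding simplex of [L] would be empty. *)
Lemma hasse_descend K L F G (FG : @hasse_iso K L F G) x
    (C : {set vertex L}) (g : vertex L -> vertex K) :
  x \in simplices K -> {in C &, injective g} -> C \subset F x ->
  (forall c, c \in C -> [/\ g c \notin x, g c |: x \in simplices K &
     F (g c |: x) = F x :\ c]) ->
  forall B : {set vertex L}, B \subset C -> B != F x ->
  g @: B :|: x \in simplices K /\ F (g @: B :|: x) = F x :\: B.
Proof.
move=> xK gI CX gC B; have [n] := ubnP #|B|; elim: n B => // n IH B Bn BC BX.
have [->|[b bB]] := set_0Vmem B; first by rewrite imset0 set0U setD0.
have [B1|[c]] := set_0Vmem (B :\ b).
  have -> : B = [set b].
    by rewrite -(setD1K bB) B1 setU0.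
  by rewrite imset_set1; have [_ ->] := gC b (subsetP BC _ bB).
rewrite !inE => /andP[cb cB].
(* Induction gives the corners for [A], [b |: A] and [c |: A] of a square; [hasse_square_inv]
   supplies the fourth one, for [B]. *)
pose A := B :\ b :\ c.
have DB : B = b |: (c |: A) by rewrite !setD1K // !inE cb.
have cA : c \notin A by rewrite !inE eqxx.
have bA : b \notin A by rewrite !inE eqxx !andbF.
clearbody A; subst B.
have [bC cC AC] : [/\ b \in C, c \in C & A \subset C].
  split; rewrite ?(subsetP BC) //.
  by apply: subset_trans BC; rewrite setUA subsetUr.
have XK (y : {set vertex L}) : y \subset F x -> y != set0 -> y \in simplices L.
  move=> yX y0; exact: simplices_sub (hasse_in FG xK) yX y0.
have gN d (D : {set vertex L}) :
    d \in C -> D \subset C -> d \notin D -> g d \notin g @: D :|: x.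
  move=> dC DC dD; rewrite inE negb_or; have [-> _ _] := gC d dC; rewrite andbT.
  apply: contra dD => /imsetP[d' d'D /gI ->] //; exact: (subsetP DC).
have card1 d (D : {set vertex L}) : d \notin D -> #|d |: D| = #|D|.+1.
  by move=> h; rewrite cardsU1 h.
have cardb : #|b |: (c |: A)| = #|A|.+2.
  by rewrite !card1 // !inE negb_or eq_sym cb.
rewrite cardb in Bn.
have ltX (D : {set vertex L}) :
    D \subset b |: (c |: A) -> #|D| < #|A|.+2 -> D != F x.
  move=> DB Dn; apply: contraTneq Dn => DX.
  by rewrite -leqNgt -cardb subset_leq_card // DX (subset_trans BC CX).
have sA : A \subset b |: (c |: A) by rewrite setUA subsetUr.
have sc : c |: A \subset b |: (c |: A) by rewrite subsetUr.
have sb : b |: A \subset b |: (c |: A) by rewrite setUS ?subsetUr.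
have [AK AF] := IH A (ltnW Bn) AC (ltX _ sA (ltnW (ltnSn _))).
have cU : #|c |: A| < #|A|.+2 by rewrite card1.
have bU : #|b |: A| < #|A|.+2 by rewrite card1.
have [cK cF] := IH _ (leq_trans cU Bn) (subset_trans sc BC) (ltX _ sc cU).
have [bK bF] := IH _ (leq_trans bU Bn) (subset_trans sb BC) (ltX _ sb bU).
rewrite !imsetU1 -!setUA in bK bF cK cF *.
have fb : flip (g b) (g @: A :|: x) = g b |: (g @: A :|: x).
  by rewrite flip_notin // gN.
have fc : flip (g c) (g @: A :|: x) = g c |: (g @: A :|: x).
  by rewrite flip_notin // gN.
have fbc : flip (g b) (g c |: (g @: A :|: x)) = g b |: (g c |: (g @: A :|: x)).
  rewrite flip_notin // in_setU1 negb_or gN // andbT.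
  by apply: contra cb => /eqP/gI ->.
have inX d : d \in C -> d \notin A -> d \in F x :\: A.
  by move=> dC dA; rewrite inE dA (subsetP CX).
have Xb : flip b (F x :\: A) = F x :\: (b |: A).
  by rewrite flip_in ?inX // setDDl setUC.
have Xc : flip c (F x :\: A) = F x :\: (c |: A).
  by rewrite flip_in ?inX // setDDl setUC.
have Xbc : flip b (F x :\: (c |: A)) = F x :\: (b |: (c |: A)).
  rewrite flip_in; first by rewrite setDDl setUC.
  by rewrite in_setD in_setU1 negb_or eq_sym cb bA (subsetP CX).
rewrite -fbc -Xbc -fc -Xc -AF.
apply: (hasse_square_inv FG) => //; rewrite ?fb ?fc ?AF ?Xb ?Xc ?Xbc //.
  by rewrite eq_sym.
(* The fourth corner in [L] is nonempty, since [B] is contained in [F x] and differs from it. *)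
apply: XK; first exact: subsetDl.
rewrite setD_eq0; apply: contra BX => h.
by rewrite eqEsubset h (subset_trans BC CX).
Qed.

Lemma setD1_neq0 (T : finType) (A : {set T}) c :
  1 < #|A| -> A :\ c != set0.
Proof.
move=> A2; rewrite -card_gt0 -(ltn_add2l (c \in A)) -cardsD1 addn0.
by apply: leq_ltn_trans A2; case: (c \in A).
Qed.

(** * Cubes at a neighbouring simplex, and the star of a vertex with a large image *)

Section Neighbours.
Variables (K L : simplicial_complex).
Variables (F : {set vertex K} -> {set vertex L}).
Variables (G : {set vertex L} -> {set vertex K}).
Hypothesis FG : hasse_iso F G.

(** Each [c] in [C] still gives a downward direction at [flip e x]: the square in directions [g c]
    and [e] closes, because its fourth corner in [L] contains [d]. As [d] survives the removal of
    all of [C], the cube at [flip e x] is complete even when [C = F x]. *)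
Lemma hasse_descend_flip x (C : {set vertex L}) (g : vertex L -> vertex K) e d :
  x \in simplices K -> {in C &, injective g} -> C \subset F x ->
  (forall c, c \in C -> [/\ g c \notin x, g c |: x \in simplices K &
     F (g c |: x) = F x :\ c]) ->
  flip e x \in simplices K -> F (flip e x) = d |: F x -> d \notin F x ->
  e \notin g @: C ->
  g @: C :|: flip e x \in simplices K /\
  F (g @: C :|: flip e x) = (d |: F x) :\: C.
Proof.
move=> xK gI CX gC eK Fe dX eC; rewrite -Fe.
apply: (hasse_descend FG (C := C)) => //.
- by rewrite Fe (subset_trans CX) // subsetUr.
- move=> c cC; have [gcx gcK Fc] := gC c cC.
  have cX := subsetP CX _ cC.
  have ce : g c != e by apply: contraNneq eC => <-; apply: imset_f.
  have cd : c != d by apply: contraNneq dX => <-.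
  have gce : g c \notin flip e x by rewrite in_flip (negbTE gcx) (negbTE ce).
  have E : (d |: F x) :\ c = flip c (flip d (F x)).
    by rewrite (flip_notin dX) flip_in // !inE cX orbT.
  rewrite Fe E -(flip_notin gce); split=> //.
    apply: (hasse_square_inv FG cd _ _ _ _ _ _).1 => //.
    - by rewrite flip_notin.
    - by rewrite flip_notin // flip_in.
    - by rewrite Fe flip_notin.
    rewrite -E; apply: simplices_sub (hasse_in FG eK) _ _.
      by rewrite Fe subsetDl.
    by apply/set0Pn; exists d; rewrite !inE eqxx eq_sym cd.
  apply: (hasse_square_inv FG cd _ _ _ _ _ _).2 => //.
  - by rewrite flip_notin.
  - by rewrite flip_notin // flip_in.
  - by rewrite Fe flip_notin.
  rewrite -E; apply: simplices_sub (hasse_in FG eK) _ _.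
    by rewrite Fe subsetDl.
  by apply/set0Pn; exists d; rewrite !inE eqxx eq_sym cd.
- by apply: contraNneq dX => CF; rewrite (subsetP CX) // CF Fe setU11.
Qed.

Variable v : vertex K.
Let t := F [set v].
Hypothesis t2 : 1 < #|t|.

Let vK : [set v] \in simplices K := simplices_set1 v.
Let tL : t \in simplices L := hasse_in FG vK.

(** A facet [t :\ c] is nonempty because [t] has at least two elements, and [G] takes it to a
    neighbour of [[set v]]. Such a neighbour is an edge, whose other end is [g c]. *)
Lemma exists_link_map : exists g : vertex L -> vertex K,
  {in t &, injective g} /\ forall c, c \in t ->
    [/\ g c \notin [set v], g c |: [set v] \in simplices K
      & F (g c |: [set v]) = t :\ c].
Proof.
have /fin_all_exists[g gP] (c : vertex L) : exists a, c \in t ->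
    [/\ a \notin [set v], a |: [set v] \in simplices K
      & F (a |: [set v]) = t :\ c].
  have [ct|] := boolP (c \in t); last by exists v.
  have cL : flip c t \in simplices L.
    rewrite flip_in //; apply: simplices_sub tL (subsetDl _ _) _.
    exact: setD1_neq0.
  have [a] := hasse_flip_inv FG tL cL.
  rewrite (hasseK FG) // => Ga; exists a => _.
  have aK : flip a [set v] \in simplices K by rewrite -Ga (hasse_in_inv FG).
  have av : a \notin [set v].
    apply: contraL aK => av; rewrite flip_in //; move: av => /set1P ->.
    by rewrite setDv simplices_neq0.
  rewrite -(flip_notin av); split=> //.
  by rewrite -Ga (hasse_invK FG) // flip_in.
exists g; split=> // b c bt ct gbc.
have [_ _ Fb] := gP b bt; have [_ _ Fc] := gP c ct.
apply/eqP; move: Fc; rewrite -gbc Fb => /setP/(_ b).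
by rewrite !inE eqxx bt /= andbT; case: eqP.
Qed.

Variable g : vertex L -> vertex K.
Hypothesis gI : {in t &, injective g}.
Hypothesis gP : forall c, c \in t ->
    [/\ g c \notin [set v], g c |: [set v] \in simplices K
      & F (g c |: [set v]) = t :\ c].

Lemma star_faces (B : {set vertex L}) : B \subset t -> B != t ->
  g @: B :|: [set v] \in simplices K /\ F (g @: B :|: [set v]) = t :\: B.
Proof. exact: (hasse_descend FG vK gI (subxx _) gP). Qed.

Lemma link_mapE c : c \in t -> g c != v.
Proof. by move/gP => [/set1P/eqP]. Qed.

(* Otherwise this simplex would be mapped to the empty set. *)
Lemma star_missing : g @: t :|: [set v] \notin simplices K.
Proof.
have /card_gt1P[a [b [at_ bt ab]]] := t2.
(* The simplex belonging to [A] is mapped to [[set a; b]]. The square above it in directions [g a]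
   and [g b] would have its top mapped to the empty set. *)
pose A := t :\ a :\ b.
have At : A \subset t by rewrite /A setDDl subsetDl.
have aA : a \notin A by rewrite !inE eqxx andbF.
have bA : b \notin A by rewrite !inE eqxx.
have DA : t :\: A = [set a; b].
  apply/setP => c; rewrite !inE.
  have [->|_] := eqVneq c b; first by rewrite bt orbT.
  by have [->|_] := eqVneq c a; [rewrite at_ | case: (c \in t)].
have Dt : a |: (b |: A) = t.
  by rewrite !setD1K // !inE bt eq_sym ab.
have gN c (B : {set _}) : c \in t -> B \subset t -> c \notin B ->
    flip (g c) (g @: B :|: [set v]) = g @: (c |: B) :|: [set v].
  move=> ct Bt cB; rewrite flip_notin ?imsetU1 ?setUA //.
  rewrite inE inE negb_or link_mapE // andbT.
  apply: contra cB => /imsetP[d dB /gI ->] //; exact: (subsetP Bt).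
have sub c : c \in t -> c |: A \subset t.
  by move=> ct; rewrite subUset sub1set ct.
have neq (B : {set _}) c : c \in t -> c \notin B -> B != t.
  by move=> ct; apply: contraNneq => ->.
have [AK FA] := star_faces At (neq _ _ at_ aA).
have abA : a \notin b |: A by rewrite !inE eqxx andbF orbF.
have baA : b \notin a |: A by rewrite !inE eqxx eq_sym orbF.
have [aK Fa] := star_faces (sub _ at_) (neq _ _ bt baA).
have [bK Fb] := star_faces (sub _ bt) (neq _ _ at_ abA).
have E : F (flip (g a) (g @: A :|: [set v])) = flip a (F (g @: A :|: [set v])).
  rewrite gN // Fa FA DA flip_in ?set21 // setUC -setDDl DA.
  by apply/setP => c; rewrite !inE; case: eqP.
have E' : F (flip (g b) (g @: A :|: [set v])) = flip b (F (g @: A :|: [set v])).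
  rewrite gN // Fb FA DA flip_in ?set22 // setUC -setDDl DA.
  by apply/setP => c; rewrite !inE; case: eqP.
apply/negP => tK.
have gab : g a != g b by apply: contra_neq ab; apply: gI.
have faK : flip (g a) (g @: A :|: [set v]) \in simplices K by rewrite gN.
have fbK : flip (g b) (g @: A :|: [set v]) \in simplices K by rewrite gN.
have fabK : flip (g a) (flip (g b) (g @: A :|: [set v])) \in simplices K.
  by rewrite (gN b) // gN ?Dt // subUset sub1set bt.
have := hasse_in FG fabK.
rewrite (hasse_square FG gab AK faK fbK E E' fabK) FA DA.
suff -> : flip a (flip b [set a; b]) = set0.
  by rewrite (negbTE (simplices_neq0 L)).
apply/setP => c; rewrite !inE; case: (eqVneq c a) => [->|_].
  by rewrite (negbTE ab).
by case: eqP.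
Qed.

(** For any other neighbour [y], the image of the edge lies above [t]. The complete cube at this
    edge, from [hasse_descend_flip] with [C = t], would then contain the simplex excluded by
    [star_missing]. *)
Lemma link_map_onto y : y != v -> [set v; y] \in simplices K -> y \in g @: t.
Proof.
move=> yv vyK; apply: contraT => yt.
have yv1 : y \notin [set v] by rewrite inE.
have yK : flip y [set v] \in simplices K by rewrite flip_notin // setUC.
have [d Fd] := hasse_flip FG vK yK.
(* A downward direction [d] is already taken by [g d], which would force [y = g d]. *)
have dt : d \notin t.
  apply: contra yt => dt; move: Fd; rewrite -/t (flip_in dt).
  have [gv gK <-] := gP dt; rewrite flip_notin // => /(hasse_inj FG) E.
  have : y \in y |: [set v] by rewrite setU11.
  rewrite E ?inE ?(negbTE yv) ?orbF => [/eqP -> | | //]; first exact: imset_f.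
  by rewrite -(flip_notin yv1).
rewrite -/t (flip_notin dt) in Fd.
have [UK _] := hasse_descend_flip vK gI (subxx _) gP yK Fd dt yt.
suff : g @: t :|: [set v] \in simplices K by rewrite (negbTE star_missing).
apply: simplices_sub UK _ _; first by rewrite setUS // flip_notin // subsetUr.
by apply/set0Pn; exists v; rewrite !inE eqxx orbT.
Qed.

End Neighbours.

(** * Boundaries of simplices *)

Section LargeImage.
Variables (K L : simplicial_complex).
Variables (F : {set vertex K} -> {set vertex L}).
Variables (G : {set vertex L} -> {set vertex K}).
Hypothesis FG : hasse_iso F G.

(** The neighbours of [v] are exactly the [g c]. The count turns inclusions of closed neighbourhoods
    into equalities, and gives the degree 2 in the case of cycles. *)
Lemma card_closed_neighbourhood v : 1 < #|F [set v]| ->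
  #|[set y | [set v; y] \in simplices K]| = #|F [set v]|.+1.
Proof.
move=> t2; have [g [gI gP]] := exists_link_map FG t2.
have -> : [set y | [set v; y] \in simplices K] = v |: g @: F [set v].
  apply/setP => y; rewrite !inE.
  have [->|yv] /= := eqVneq y v; first by rewrite setUid simplices_set1.
  apply/idP/idP => [vyK|/imsetP[c ct ->]].
    by apply: (link_map_onto FG t2 gI gP).
  by have [_] := gP c ct; rewrite setUC.
rewrite cardsU1 card_in_imset //.
suff -> : v \notin g @: F [set v] by [].
by apply/imsetP => -[c /gP[/set1P/eqP gv _ _] E]; rewrite -E eqxx in gv.
Qed.

(** From the edge [x] on [v] and [g c], dropping [v] leads to [[set g c]], whose image is [F x] with
    a new element [z]. The complete cube there, in the directions [g b] with [b] in [t :\ c], ends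
    in [g @: t], whose image retains only [z]. *)
Lemma opposite_face v (g : vertex L -> vertex K) : 2 < #|F [set v]| ->
  {in F [set v] &, injective g} ->
  (forall c, c \in F [set v] ->
    [/\ g c \notin [set v], g c |: [set v] \in simplices K
      & F (g c |: [set v]) = F [set v] :\ c]) ->
  forall c, c \in F [set v] -> exists z,
   [/\ #|F [set g c]| = #|F [set v]|, g @: F [set v] \in simplices K
     & F (g @: F [set v]) = [set z]].
Proof.
set t := F [set v] => t3 gI gP c ct.
have t2 : 1 < #|t| by apply: ltnW.
have gv b : b \in t -> g b != v by move/gP => [/set1P/eqP].
have [gcv xK Fx] := gP c ct.
set x := g c |: [set v] in xK Fx.
have flipv : flip v x = [set g c].
  rewrite flip_in ?set22 //; apply/setP => y; rewrite !inE.
  by have [->|] := eqVneq y v; rewrite ?orbF // eq_sym (negbTE (gv c ct)).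
have vxK : flip v x \in simplices K by rewrite flipv simplices_set1.
have [z Fz] := hasse_flip FG xK vxK.
have Cx b : b \in t :\ c -> [/\ g b \notin x, g b |: x \in simplices K &
     F (g b |: x) = F x :\ b].
  rewrite !inE => /andP[bc bt].
  have bct : [set b; c] \subset t by rewrite subUset !sub1set bt.
  (* Three elements of [t] make the triangle on [v], [g b] and [g c] a simplex. *)
  have bcn : [set b; c] != t.
    by apply: contraTneq t3 => <-; rewrite cards2; case: (b != c).
  have [] := star_faces FG gI gP bct bcn.
  rewrite imsetU1 imset_set1 -setUA => K1 F1; split=> //.
    rewrite negb_or (gv b) // andbT; apply: contra bc => /eqP/gI -> //.
  by rewrite F1 Fx setDDl setUC.
(* A downward direction [z] at [x] is already taken by [g z], which differs from [v]. *)
have zx : z \notin F x.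
  rewrite Fx; apply/negP => zt; have [_ zK E] := Cx z zt.
  move: Fz; rewrite (flip_in (a := z)) -?E ?Fx //.
  move/(hasse_inj FG vxK zK) => /setP/(_ v).
  by rewrite flipv !inE eqxx !orbT eq_sym (negbTE (gv c ct)).
have zc : z <> c.
  move=> zc; move: Fz; rewrite zc Fx.
  rewrite (flip_notin (a := c)) ?setD1K ?inE ?eqxx //.
  move=> Fz; have /setP/(_ v) := hasse_inj FG vxK (simplices_set1 v) Fz.
  by rewrite flipv !inE eqxx eq_sym (negbTE (gv c ct)).
rewrite (flip_notin zx) in Fz.
have tcI : {in t :\ c &, injective g}.
  by move=> a b /setD1P[_ at_] /setD1P[_ bt]; apply: gI.
have tcx : t :\ c \subset F x by rewrite Fx.
have vtc : v \notin g @: (t :\ c).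
  by apply/imsetP => -[b /setD1P[_ /gv/eqP]] E /esym.
have [] := hasse_descend_flip FG xK tcI tcx Cx vxK Fz zx vtc.
rewrite flipv setUC -imset_set1 -imsetU setD1K // => tK Ft.
exists z; split=> //.
- by rewrite imset_set1 -flipv Fz cardsU1 zx Fx (cardsD1 c t) ct.
- rewrite Ft Fx; apply/setP => b; rewrite !inE.
  have [->|bz] /= := eqVneq b z; last by rewrite andNb.
  by move: zx; rewrite Fx !inE => ->.
Qed.

(** Once [v] and the [g c] are known to be all vertices, the sets avoiding [v] are faces of [g @: F
    [set v]], and a proper subset containing [v] avoids some [g c] and is covered by [star_faces].
    The simplex [g @: F [set v]] is also [G [set z]] for the last conclusion. *)
Lemma large_image v : connected_complex K -> 2 < #|F [set v]| ->
  [/\ forall x, (x \in simplices K) = (x != set0) && (x != setT),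
      #|vertex K| = #|F [set v]|.+1
    & exists z, #|G [set z]| = #|F [set v]|].
Proof.
move=> Kc t3; have t2 : 1 < #|F [set v]| by apply: ltnW.
have [g [gI gP]] := exists_link_map FG t2.
have opp := opposite_face t3 gI gP.
have /card_gt0P[c0 c0t] : 0 < #|F [set v]| by apply: ltnW.
have [z [_ tK Fz]] := opp c0 c0t.
have gtv : g @: F [set v] :|: [set v] = setT.
  (* Each [g c] has the same closed neighbourhood as [v]: it is adjacent to all the [g d], which lie
     with it in one simplex, and the cardinalities agree. Hence [N v] is closed under adjacency. *)
  pose N w := [set y | [set w; y] \in simplices K].
  have vN : N v = g @: F [set v] :|: [set v].
    apply/setP => y; rewrite !inE orbC.
    have [->|yv] /= := eqVneq y v; first by rewrite setUid simplices_set1.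
    apply/idP/idP => [vyK|/imsetP[c ct ->]].
      by apply: (link_map_onto FG t2 gI gP).
    by have [_] := gP c ct; rewrite setUC.
  rewrite -vN; apply: (connected_closed (u := v)) => //.
    by rewrite inE setUid simplices_set1.
  move=> y w yN _ yw; suff -> : N v = N y by rewrite inE.
  move: yN; rewrite {1}vN in_setU; case/orP => [/imsetP[c ct ->]|/set1P -> //].
  have [_ [Fc _ _]] := opp c ct.
  apply/eqP; rewrite eqEcard !card_closed_neighbourhood // Fc // leqnn andbT.
  apply/subsetP => b; rewrite vN !inE => /orP[/imsetP[d dt ->]|/eqP ->].
    apply: simplices_sub tK _ _; first by rewrite subUset !sub1set !imset_f.
    by apply/set0Pn; exists (g c); rewrite set21.
  by have [_] := gP c ct.
split.
- move=> x; apply/idP/andP => [xK|[x0 xT]].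
    split; first exact: simplex_neq0.
    by apply: contraTneq xK => ->; rewrite -gtv (star_missing FG).
  have [vx|vx] := boolP (v \in x); last first.
    apply: simplices_sub tK _ x0; apply/subsetP => y yx.
    have : y \in setT by rewrite inE.
    rewrite -gtv !inE => /orP[//|/eqP E].
    by rewrite -E yx in vx.
  have [y yx] : exists y, y \notin x.
    by apply/existsP; rewrite -negb_forall; apply: contra xT => /forallP h;
       apply/eqP/setP => y; rewrite h inE.
  have : y \in setT by rewrite inE.
  rewrite -gtv !inE => /orP[/imsetP[c ct E]|/eqP E]; last first.
    by rewrite E vx in yx.
  have [|K1 _] := star_faces FG gI gP (subsetDl _ [set c]).
    by apply/eqP => /setP/(_ c); rewrite !inE eqxx ct.
  apply: simplices_sub K1 _ x0; apply/subsetP => b bx.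
  have : b \in setT by rewrite inE.
  rewrite -gtv !inE => /orP[/imsetP[d dt Eb]|->]; last by rewrite orbT.
  rewrite Eb imset_f // !inE dt andbT.
  by apply: contraNneq yx => dc; rewrite E -dc -Eb.
- rewrite -cardsT -gtv setUC cardsU1 card_in_imset //.
  suff -> : v \notin g @: F [set v] by [].
  by apply/imsetP => -[c /gP[/set1P/eqP gv _ _] E]; rewrite -E eqxx in gv.
- by exists z; rewrite -Fz (hasseK FG) // card_in_imset.
Qed.

End LargeImage.

Lemma card_bijection (T U : finType) : #|T| = #|U| ->
  exists f : T -> U, bijective f.
Proof.
move=> TU; exists (fun x => enum_val (cast_ord TU (enum_rank x))).
exists (fun y => enum_val (cast_ord (esym TU) (enum_rank y))) => x.
  by rewrite enum_valK cast_ordK enum_rankK.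
by rewrite enum_valK cast_ordKV enum_rankK.
Qed.

Lemma boundary_isomorphic K L :
  (forall x, (x \in simplices K) = (x != set0) && (x != setT)) ->
  (forall x, (x \in simplices L) = (x != set0) && (x != setT)) ->
  #|vertex K| = #|vertex L| -> isomorphic K L.
Proof.
move=> KE LE /card_bijection[f fb]; exists f => // s; have [g fK gK] := fb.
have fT : f @: setT = setT.
  by apply/setP => y; rewrite inE -[y]gK imset_f ?inE.
by rewrite LE KE imset_eq0 -{1}fT (inj_eq (imset_inj (can_inj fK))).
Qed.

(** The vertex [z] given by [large_image] has a large image under [G], so the lemma applies to [L]
    as well. *)
Lemma large_isomorphic K L F G v : connected_complex K -> connected_complex L ->
  @hasse_iso K L F G -> 2 < #|F [set v]| -> isomorphic K L.
Proof.
move=> Kc Lc FG v3; have [KE Kn [z zn]] := large_image FG Kc v3.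
have z3 : 2 < #|G [set z]| by rewrite zn.
have [LE Ln _] := large_image (hasse_iso_sym FG) Lc z3.
by apply: boundary_isomorphic => //; rewrite Kn Ln zn.
Qed.

(** * Dimension-preserving isomorphisms *)

(** In the hypercube, [[set a]] and [[set b]] have only two common neighbours, one of them empty. *)
Lemma flip_set1 (V : finType) (a b c d : V) x : a != b ->
  x = flip c [set a] -> x = flip d [set b] -> x != set0 -> x = [set a; b].
Proof.
move=> ab E E' x0.
have ax : a \in x.
  rewrite E !inE eqxx /=; apply: contraNneq x0 => ac.
  by rewrite E -ac flip_in ?set11 // setDv.
move: ax; rewrite E' !inE (negbTE ab) => /eqP <-.
by rewrite flip_notin // inE.
Qed.

(** With [f] read off from the vertices, [F x = f @: x] follows by induction on [#|x|]: a simplex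
    with at least three elements is the top of a square whose other corners are smaller
    simplices. *)
Lemma dim_preserving_isomorphic K L F G : @hasse_iso K L F G ->
  (forall v, #|F [set v]| = 1) -> isomorphic K L.
Proof.
move=> FG F1.
have /fin_all_exists[f Ff] v : exists z, F [set v] = [set z].
  by apply/cards1P; rewrite F1.
have fI : injective f.
  move=> v w E; apply: set1_inj.
  by apply: (hasse_inj FG); rewrite ?simplices_set1 // !Ff E.
have FE x : x \in simplices K -> F x = f @: x.
  have [n] := ubnP #|x|; elim: n x => // n IH x xn xK.
  have [a ax] := set0Pn _ (simplex_neq0 xK).
  have subK (y : {set vertex K}) :
      y \subset x -> y != set0 -> y \in simplices K.
    exact: simplices_sub xK.
  have subE (y : {set vertex K}) :
      y \subset x -> y != set0 -> y != x -> F y = f @: y.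
    move=> yx y0 ynx; apply: IH; last exact: subK.
    apply: (@leq_trans #|x|) => //.
    by apply: proper_card; rewrite properEneq ynx.
  have [x1|[b]] := set_0Vmem (x :\ a).
    by rewrite -(setD1K ax) x1 setU0 imset_set1.
  move=> /setD1P[ba bx]; rewrite -(setD1K ax).
  have axK : x :\ a \in simplices K.
    by apply: subK (subsetDl _ _) _; apply/set0Pn; exists b; rewrite !inE ba.
  have bxK : x :\ b \in simplices K.
    apply: subK (subsetDl _ _) _; apply/set0Pn; exists a.
    by rewrite !inE eq_sym ba.
  have Dneq c : c \in x -> x :\ c != x.
    by move=> cx; apply: contraTneq cx => <-; rewrite !inE eqxx.
  have Fa : F (x :\ a) = f @: (x :\ a).
    by apply: subE (subsetDl _ _) (simplex_neq0 axK) (Dneq a ax).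
  have Fb : F (x :\ b) = f @: (x :\ b).
    by apply: subE (subsetDl _ _) (simplex_neq0 bxK) (Dneq b bx).
  have fx : flip a (x :\ a) = x by rewrite flip_notin ?setD1K // !inE eqxx.
  (* An edge has no square below it, the empty set not being a simplex; its image is determined as a
     common neighbour of two points. *)
  have [y0|y0] := eqVneq (x :\ a :\ b) set0.
    have xb : x :\ a = [set b].
      by rewrite -(setD1K (a := b) (A := x :\ a)) ?y0 ?setU0 // !inE ba.
    have xa : x :\ b = [set a].
      apply/setP => c; move/setP/(_ c): y0; rewrite !inE.
      have [->|_] := eqVneq c a; first by rewrite eq_sym ba ax.
      by [].
    have fx' : flip b (x :\ b) = x by rewrite flip_notin ?setD1K // !inE eqxx.
    have faK : flip a (x :\ a) \in simplices K by rewrite fx.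
    have fbK : flip b (x :\ b) \in simplices K by rewrite fx'.
    have [c Fc] := hasse_flip FG axK faK.
    have [d Fd] := hasse_flip FG bxK fbK.
    rewrite fx xb Ff in Fc; rewrite fx' xa Ff in Fd.
    rewrite setD1K // -[in RHS](setD1K ax) xb imsetU1 imset_set1.
    apply: (flip_set1 _ Fd Fc); last exact: simplex_neq0 (hasse_in FG xK).
    by rewrite (inj_eq fI) eq_sym.
  have yx : x :\ a :\ b \subset x by rewrite setDDl subsetDl.
  have yK := subK _ yx y0.
  have Fy : F (x :\ a :\ b) = f @: (x :\ a :\ b).
    apply: subE => //; apply: contraTneq ax => <-.
    by rewrite !inE eqxx andbF.
  have fby : flip b (x :\ a :\ b) = x :\ a.
    by rewrite flip_notin ?setD1K // !inE ?eqxx ?ba.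
  have fay : flip a (x :\ a :\ b) = x :\ b.
    rewrite setDDl setUC -setDDl.
    by rewrite flip_notin ?setD1K // !inE ?eqxx // eq_sym ba.
  have im c (z : {set _}) : c \notin z -> f @: flip c z = flip (f c) (f @: z).
    by move=> cz; rewrite !flip_notin ?imsetU1 // mem_imset.
  have ay : a \notin x :\ a :\ b by rewrite !inE eqxx andbF.
  have byy : b \notin x :\ a :\ b by rewrite !inE eqxx.
  have ab : a != b by rewrite eq_sym.
  have fabx : flip a (flip b (x :\ a :\ b)) = x by rewrite fby.
  rewrite setD1K // -fabx.
  have -> := hasse_square FG (c := f a) (d := f b) ab yK.
  - by rewrite Fy -im // -im // fby !inE eqxx.
  - by rewrite fay.
  - by rewrite fby.
  - by rewrite Fy -im // fay.
  - by rewrite Fy -im // fby.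
  - by rewrite fabx.
(* By [FE], the simplex [G [set z]] has as many elements as its image [[set z]]. *)
have fS z : exists v, f v = z.
  have zL := simplices_set1 z.
  have GK := hasse_in_inv FG zL.
  have /cards1P[v Gv] : #|G [set z]| == 1.
    by rewrite -(card_imset _ fI) -FE // (hasse_invK FG) // cards1.
  exists v; apply: set1_inj; rewrite -Ff -Gv; exact: hasse_invK FG _ zL.
have [g gK] := fin_all_exists fS.
have fK : cancel f g by move=> v; apply: fI; rewrite gK.
exists f => [|s]; first by exists g.
apply/idP/idP => [fsL|sK]; last by rewrite -FE // (hasse_in FG).
have GK := hasse_in_inv FG fsL.
suff <- : G (f @: s) = s by [].
by apply: (imset_inj fI); rewrite -FE // (hasse_invK FG).
Qed.

(** * Cycles *)

(** [O] is the orbit of one dart under the walk that never turns back. By connectedness the orbit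
    reaches every vertex, and it never contains a dart together with its reverse, so it orients each
    edge exactly once. *)
Lemma two_regular_orientation (V : finType) (e : rel V) (v0 : V) :
  symmetric e -> irreflexive e -> (forall v, #|[set w | e v w]| = 2) ->
  (forall u v, connect e u v) ->
  exists O : rel V,
    [/\ forall u v, e u v = O u v || O v u,
        forall u v, O u v -> ~~ O v u,
        forall u, exists v, O u v,
        forall v, exists u, O u v
      & forall u v w, O u v -> O u w -> v = w].
Proof.
move=> eC eI e2 ec.
(* The vertex after [u] and [v] on a walk. If [u] is a neighbour of [v], there is a second one and
   the default [u] is not taken. *)
pose other u v := odflt u [pick w | e v w && (w != u)].
have otherP u v : e v u ->
    [/\ e v (other u v), other u v != u
      & forall w, e v w -> w = u \/ w = other u v].
  move=> vu; have /eqP/cards2P[a [b [ab E]]] := e2 v.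
  have eE w : e v w = (w == a) || (w == b).
    by move/setP/(_ w): E; rewrite !inE.
  rewrite /other; case: pickP => [w /andP[vw wu] | H] /=.
    split=> // z; move: vu vw wu; rewrite !eE.
    do 2! (case/orP => /eqP ->); rewrite ?eqxx // => _;
      by case/orP => /eqP ->; auto.
  have := H a; have := H b; rewrite !eE !eqxx ?orbT /= => /negbFE/eqP <-.
  by rewrite (negbTE ab).
(* [s] walks along darts and [r] reverses them. A reversal [iter n s d = r d]
   would give, by [srs], one for [n - 2], hence one for [n = 0] or [n = 1]. *)
pose r (d : V * V) := (d.2, d.1).
pose s (d : V * V) := if e d.1 d.2 then (d.2, other d.1 d.2) else d.
have rK : involutive r by case.
have srs d : s (r (s d)) = r d.
  case: d => u v; rewrite /s /r /=; case: (boolP (e u v)) => uv /=; last first.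
    by rewrite eC (negbTE uv).
  rewrite eC in uv; have [vw wu vN] := otherP _ _ uv.
  rewrite eC vw; congr pair; have [vx xw _] := otherP _ _ vw.
  by case: (vN _ vx) => // E; rewrite E eqxx in xw.
(* [srs] recovers [r d] from [s d], also off the darts, where [s] is the identity. Injectivity makes
   [fconnect s] symmetric. *)
have sI : injective s.
  by move=> d d' E; apply: (can_inj rK); rewrite -srs E srs.
have s_dart d : e d.1 d.2 -> e (s d).1 (s d).2.
  by move=> ed; rewrite /s ed /=; rewrite eC in ed; have [] := otherP _ _ ed.
have no_reverse n d : e d.1 d.2 -> iter n s d <> r d.
  have [m] := ubnP n; elim: m n d => // m IH [|[|n]] [u v] nm ed /=.
  - by case=> E _; move: ed; rewrite /= E eI.
  - rewrite /s ed /=; rewrite /= eC in ed.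
    by case=> E; have [_ /eqP] := otherP _ _ ed.
  - move=> E; apply: (IH n (s (u, v))); first exact: ltnW.
      exact: s_dart.
    by apply: sI; rewrite srs -E -iterSr.
have [y0 e0] : exists y, e v0 y.
  have /card_gt0P[y] : 0 < #|[set w | e v0 w]| by rewrite e2.
  by rewrite inE; exists y.
pose d0 := (v0, y0).
have O_dart d : fconnect s d0 d -> e d.1 d.2.
  move=> /iter_findex <-; elim: (findex _ _ _) => //= n; exact: s_dart.
pose O u v := fconnect s d0 (u, v).
have succ u v : O u v -> O v (other u v).
  move=> Ouv; have euv := O_dart _ Ouv.
  have := fconnect1 s (u, v); rewrite {2}/s euv; exact: connect_trans.
have pred u v : O u v -> O (other v u) u.
  move=> Ouv; have euv := O_dart _ Ouv; rewrite /= in euv.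
  apply: connect_trans Ouv _; rewrite fconnect_sym //.
  have E : s (other v u, u) = (u, v).
    have := srs (r (u, v)); rewrite rK /s /r /= [e v u]eC euv /=.
    by [].
  by rewrite -E fconnect1.
have O_anti u v : O u v -> ~~ O v u.
  move=> Ouv; apply/negP => Ovu.
  have c : fconnect s (u, v) (v, u).
    by apply: connect_trans Ovu; rewrite fconnect_sym.
  exact: (no_reverse _ _ (O_dart _ Ouv) (iter_findex c)).
have O_out u : exists v, O u v.
  (* The two neighbours of a vertex on the orbit are its successor and its predecessor, so [S] is
     closed. *)
  pose S := [set u | [exists v, O u v]].
  have cl : closed e S.
    apply: intro_closed => [|x y xy]; first exact: sym_connect_sym.
    rewrite !inE => /existsP[w xw]; apply/existsP.
    have [_ _ H] := otherP w x (O_dart _ xw).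
    case: (H _ xy) => ->; first by exists (other x w); apply: succ.
    by exists x; apply: pred.
  have := closed_connect cl (ec v0 u); rewrite !inE => E.
  by apply/existsP; rewrite -E; apply/existsP; exists y0; apply: connect0.
have O_fun u v w : O u v -> O u w -> v = w.
  move=> Ouv Ouw; have [_ _ H] := otherP v u (O_dart _ Ouv).
  case: (H _ (O_dart _ Ouw)) => // E.
  by have := O_anti _ _ (pred _ _ Ouv); rewrite -E Ouw.
exists O; split=> // [u v|v].
- apply/idP/orP => [uv|[/O_dart //|/O_dart]]; last by rewrite eC.
  have [w uw] := O_out u; have [_ _ H] := otherP w u (O_dart _ uw).
  by case: (H _ uv) => ->; [left | right; apply: pred].
- by have [w vw] := O_out v; exists (other w v); apply: pred.
Qed.

Section TwoElementImages.
Variables (K L : simplicial_complex).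
Variables (F : {set vertex K} -> {set vertex L}).
Variables (G : {set vertex L} -> {set vertex K}).
Hypothesis FG : hasse_iso F G.

Lemma hasse_flip_vertex u v z : u != v -> [set u; v] \in simplices K ->
  F [set u; v] = [set z] -> exists c, F [set v] = flip c [set z].
Proof.
move=> uv uvK E.
have fu : flip u [set u; v] = [set v].
  by rewrite -flip_notin ?flipK // inE.
have fuK : flip u [set u; v] \in simplices K by rewrite fu simplices_set1.
by have [c] := hasse_flip FG uvK fuK; rewrite fu E; exists c.
Qed.

Lemma card_edge_image v w : #|F [set v]| = 2 -> v != w ->
  [set v; w] \in simplices K -> exists z, F [set v; w] = [set z].
Proof.
move=> v2 vw vwK; have t2 : 1 < #|F [set v]| by rewrite v2.
have [g [gI gP]] := exists_link_map FG t2.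
rewrite eq_sym in vw.
have /imsetP[c ct E] := link_map_onto FG t2 gI gP vw vwK.
have [_ _ Fc] := gP c ct.
apply/cards1P; rewrite setUC E Fc; move: v2.
by rewrite (cardsD1 c) ct add1n => -[->].
Qed.

(** The property passes along edges: the edge is mapped to a point of [L], and all neighbours of a
    point have two elements. *)
Lemma card_vertex_image u v : connected_complex K -> #|F [set u]| = 2 ->
  #|F [set v]| = 2.
Proof.
move=> Kc u2; pose S := [set v | #|F [set v]| == 2].
suff : S = setT by move/setP/(_ v); rewrite !inE => /eqP.
apply: (connected_closed (u := u)) => //; first by rewrite inE u2.
move=> x y; rewrite !inE => /eqP x2 xy xyK.
have [z Fz] := card_edge_image x2 xy xyK.
have [c Fy] := hasse_flip_vertex xy xyK Fz.
have := hasse_in FG (simplices_set1 y); rewrite Fy.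
have [->|cz _] := eqVneq c z.
  by rewrite flip_in ?set11 // setDv (negbTE (simplices_neq0 L)).
by rewrite flip_notin ?inE // cards2 cz.
Qed.

(** A vertex [v] has only two neighbours, so a larger simplex at [v] would be the one excluded by
    [star_missing]. *)
Lemma card_simplex_le2 x : (forall v, #|F [set v]| = 2) ->
  x \in simplices K -> #|x| <= 2.
Proof.
move=> F2 xK; have [v vx] := set0Pn _ (simplex_neq0 xK).
have t2 : 1 < #|F [set v]| by rewrite F2.
have [g [gI gP]] := exists_link_map FG t2.
rewrite leqNgt; apply: contraL (xK) => x3.
suff -> : x = g @: F [set v] :|: [set v] by apply: (star_missing FG).
apply/eqP; rewrite eqEcard; apply/andP; split.
  apply/subsetP => y yx; have [->|yv] := eqVneq y v.
    by rewrite !inE eqxx orbT.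
  rewrite inE (link_map_onto FG t2 gI gP) //.
  apply: simplices_sub xK _ _; first by rewrite subUset !sub1set vx.
  by apply/set0Pn; exists v; rewrite set21.
apply: leq_trans x3; rewrite setUC (leq_trans (leq_card_setU _ _)) // cards1.
by rewrite card_in_imset // F2.
Qed.

End TwoElementImages.

Lemma set2_inj (T : finType) (a b c d : T) :
  [set a; b] = [set c; d] -> (a = c /\ b = d) \/ (a = d /\ b = c).
Proof.
move=> E; have /set2P A : a \in [set c; d] by rewrite -E set21.
have /set2P B : b \in [set c; d] by rewrite -E set22.
have /set2P C : c \in [set a; b] by rewrite E set21.
have /set2P D : d \in [set a; b] by rewrite E set22.
by case: A => ?; case: B => ?; case: C => ?; case: D => ?; subst; auto.
Qed.

Lemma cycle_isomorphic K L F G u : connected_complex K ->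
  @hasse_iso K L F G -> #|F [set u]| = 2 -> isomorphic K L.
Proof.
move=> Kc FG u2.
have F2 v : #|F [set v]| = 2 by apply: (card_vertex_image FG) u2.
pose e : rel (vertex K) := fun v w => (v != w) && ([set v; w] \in simplices K).
have eC : symmetric e by move=> v w; rewrite /e eq_sym setUC.
have eI : irreflexive e by move=> v; rewrite /e eqxx.
have e2 v : #|[set w | e v w]| = 2.
  have := card_closed_neighbourhood FG (v := v); rewrite F2 => /(_ isT).
  rewrite (cardsD1 v) inE setUid simplices_set1 add1n => -[<-].
  by congr #|pred_of_set _|; apply/setP => w; rewrite !inE eq_sym.
have ec v w : connect e v w.
  have : [set w | connect e v w] = setT.
    apply: (connected_closed (u := v)) => //; first by rewrite inE connect0.
    move=> x y; rewrite !inE => vx xy xyK; apply: connect_trans vx _.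
    by apply: connect1; rewrite /e xy.
  by move/setP/(_ w); rewrite !inE.
have [O [eO Oanti Oout Oin Ofun]] := two_regular_orientation u eC eI e2 ec.
have /fin_all_exists[m Om] v :
    exists c, forall w, O v w -> F [set v; w] = [set c].
  have [w vw] := Oout v.
  have /andP[vw1 vwK] : e v w by rewrite eO vw.
  have [z Fz] := card_edge_image FG (F2 v) vw1 vwK.
  by exists z => w' /(Ofun _ _ _ vw) <-.
have OK v w : O v w -> v != w /\ [set v; w] \in simplices K.
  by move=> vw; apply/andP; rewrite -/(e v w) eO vw.
(* Equal values come from the same edge, and [O] orients an edge in only one direction. *)
have mI : injective m.
  move=> v v' E; have [w vw] := Oout v; have [w' vw'] := Oout v'.
  have := Om _ _ vw; rewrite E -(Om _ _ vw') => /(hasse_inj FG).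
  case/(_ (OK _ _ vw).2 (OK _ _ vw').2)/set2_inj => -[] // E1 E2.
  by have := Oanti _ _ vw; rewrite E1 E2 vw'.
(* The vertex [v] lies on its incoming and its outgoing edge, so its image is adjacent to the points
   [m t] and [m v]. *)
have mF t v : O t v -> F [set v] = [set m t; m v].
  move=> tv; have [w vw] := Oout v.
  have [[tv1 tvK] [vw1 vwK]] := (OK _ _ tv, OK _ _ vw).
  have [c Fc] := hasse_flip_vertex FG tv1 tvK (Om _ _ tv).
  rewrite eq_sym in vw1; rewrite setUC in vwK.
  have E := Om _ _ vw; rewrite setUC in E.
  have [d Fd] := hasse_flip_vertex FG vw1 vwK E.
  apply: (flip_set1 _ Fc Fd); first by rewrite (inj_eq mI).
  exact: simplex_neq0 (hasse_in FG (simplices_set1 v)).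
have simplexP x : x \in simplices K ->
    (exists v, x = [set v]) \/ (exists v w, O v w /\ x = [set v; w]).
  move=> xK; have := card_simplex_le2 FG F2 xK.
  rewrite leq_eqVlt => /orP[/cards2P[v [w [vw E]]]|x1].
    have : e v w by rewrite /e vw -E.
    rewrite eO => /orP[Ovw|Owv]; right; first by exists v, w.
    by exists w, v; rewrite setUC.
  left; apply/cards1P; rewrite eqn_leq -ltnS x1 card_gt0.
  exact: simplex_neq0.
(* The preimage of a point is an edge, since vertices are mapped to two-element simplices. *)
have mS z : exists v, m v = z.
  have zL := simplices_set1 z.
  have Fz := hasse_invK FG zL.
  case: (simplexP _ (hasse_in_inv FG zL)) => [[v E]|[v [w [vw E]]]].
    by have := F2 v; rewrite -E Fz cards1.
  by exists v; apply: set1_inj; rewrite -Fz E (Om _ _ vw).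
have [m' m'K] := fin_all_exists mS.
have mK : cancel m m' by move=> v; apply: mI; rewrite m'K.
exists m => [|s]; first by exists m'.
apply/idP/idP => [msL|/simplexP[[v ->]|[v [w [vw ->]]]]].
- have Fs := hasse_invK FG msL.
  case: (simplexP _ (hasse_in_inv FG msL)) => [[v E]|[v [w [vw E]]]].
    have [t tv] := Oin v; suff -> : s = [set t; v] by case: (OK _ _ tv).
    by apply: (imset_inj mI); rewrite -Fs E (mF _ _ tv) imsetU1 imset_set1.
  suff -> : s = [set v] by apply: simplices_set1.
  by apply: (imset_inj mI); rewrite -Fs E (Om _ _ vw) imset_set1.
- by rewrite imset_set1 simplices_set1.
- by rewrite imsetU1 imset_set1 -(mF _ _ vw) (hasse_in FG) // simplices_set1.
Qed.

Lemma hasse_isomorphic K L F G : connected_complex K -> connected_complex L ->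
  @hasse_iso K L F G -> isomorphic K L.
Proof.
move=> Kc Lc FG.
have [/existsP[v v3]|/existsPn Fle] := boolP [exists v, 2 < #|F [set v]|].
  exact: large_isomorphic Kc Lc FG v3.
have [/existsP[v /eqP v2]|/existsPn F2] := boolP [exists v, #|F [set v]| == 2].
  exact: cycle_isomorphic Kc FG v2.
apply: (dim_preserving_isomorphic FG) => v.
have := simplex_neq0 (hasse_in FG (simplices_set1 v)); rewrite -card_gt0.
by move: (Fle v) (F2 v); case: #|_| => [|[|[]]].
Qed.

(** * Line graphs of Hasse diagrams *)

Section Incidence.
Variables (R : realType) (K : simplicial_complex).
Implicit Types (s t x y : simplex K) (p q r : primitive K).

Definition incident x p := (x == (val p).1) || (x == (val p).2).

Definition star x := [set p | incident x p].

(** Adjacency in the line graph of the Hasse diagram, made reflexive. *)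
Definition meet p q := [exists x, incident x p && incident x q].

Lemma meetP p q :
  reflect (exists x, incident x p /\ incident x q) (meet p q).
Proof.
by apply: (iffP existsP) => -[x]; [move/andP | case=> xp xq]; exists x => //;
  apply/andP.
Qed.

Lemma dim_face s t : immediate_face s t -> dim t = (dim s).+1.
Proof. by case/andP => _ /eqP. Qed.

Lemma dim_primitive p : dim (val p).2 = (dim (val p).1).+1.
Proof. exact: dim_face (valP p). Qed.

(** The parity of the dimension is a 2-colouring of the Hasse diagram. *)
Lemma incident_eq x y p : incident x p -> incident y p ->
  odd (dim x) = odd (dim y) -> x = y.
Proof.
by move=> /orP[] /eqP -> /orP[] /eqP -> //; rewrite dim_primitive /=;
  case: odd.
Qed.

Lemma primitive_eq p q :
  (val p).1 = (val q).1 -> (val p).2 = (val q).2 -> p = q.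
Proof. by move=> e1 e2; apply: val_inj; apply: inj2_pair. Qed.

Lemma incident_uniq x y p q : p != q -> incident x p -> incident x q ->
  incident y p -> incident y q -> x = y.
Proof.
move=> pq xp xq yp yq; apply/eqP; apply: contraNT pq => xy.
apply/eqP; have dp := dim_primitive p; have dq := dim_primitive q.
move: xp yp xq yq xy => /orP[] /eqP -> /orP[] /eqP ->; rewrite ?eqxx //;
  move=> /orP[] /eqP E1 /orP[] /eqP E2; rewrite ?E1 ?E2 ?eqxx // => _;
  try exact: primitive_eq.
all: by exfalso; move: dp; rewrite E1 E2 dq; lia.
Qed.

(** Of the three meeting points two have the same parity and hence coincide. This rules out a
    triangle in the Hasse diagram, the exception in Whitney's theorem. *)
Lemma meet_triangle p q r : p != q -> p != r -> q != r ->
  meet p q -> meet p r -> meet q r ->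
  exists x, [/\ incident x p, incident x q & incident x r].
Proof.
move=> pq pr qr /meetP[x [xp xq]] /meetP[y [yp yr]] /meetP[z [zq zr]].
have [xy|xy] := eqVneq (odd (dim x)) (odd (dim y)).
  by exists x; rewrite {3}(incident_eq xp yp xy).
have [xz|xz] := eqVneq (odd (dim x)) (odd (dim z)).
  by exists x; rewrite {3}(incident_eq xq zq xz).
exists y; split=> //; rewrite (incident_eq yr zr) //.
by move: xy xz; do 3! case: odd.
Qed.

(** Both [t] and [t'] are the union of [s] and [s']. *)
Lemma immediate_face_square s s' t t' : s != s' ->
  immediate_face s t -> immediate_face s' t ->
  immediate_face s t' -> immediate_face s' t' -> t = t'.
Proof.
move=> ss'; suff E u : immediate_face s u -> immediate_face s' u ->
    val u = val s :|: val s'.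
  by move=> a b c d; apply: val_inj; rewrite (E t) // (E t').
rewrite !immediate_faceE => /andP[su /eqP cu] /andP[s'u /eqP cu'].
apply/eqP; rewrite eq_sym eqEcard subUset su s'u cu /=.
rewrite ltnNge; apply: contra ss' => le.
have E1 : val s = val s :|: val s' by apply/eqP; rewrite eqEcard subsetUl.
have : val s' \subset val s by rewrite E1 subsetUr.
move: cu'; rewrite cu => -[cs] s's; apply/eqP; apply: val_inj.
by apply/esym/eqP; rewrite eqEcard s's /= cs leqnn.
Qed.

(* The two conditions on faces let the pair [p] take the value 0, the pair [q]
   the value 1, and all other simplices the value 2. *)
Lemma Morse_pair_aux p q : ~~ meet p q ->
  ~~ immediate_face (val q).1 (val p).2 ->
  ~~ immediate_face (val q).1 (val p).1 ->
  [set p; q] \in Morse_simplices R K.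
Proof.
move=> pq qp2 qp1.
have npq x : incident x p -> incident x q -> False.
  by move=> xp xq; move/negP: pq; apply; apply/meetP; exists x.
have i1 r : incident (val r).1 r by rewrite /incident eqxx.
have i2 r : incident (val r).2 r by rewrite /incident eqxx orbT.
have irr r : (val r).1 != (val r).2.
  by apply: contra_eq_neq (dim_primitive r) => ->; rewrite ltn_eqF.
pose f x : R :=
  (if incident x p then 0 else if incident x q then 1 else 2)%:R%R.
have fp x : incident x p -> f x = 0%R by rewrite /f => ->.
have fq x : incident x q -> f x = 1%R.
  by rewrite /f => xq; case: ifP => [xp|_]; [case: (npq x) | rewrite xq].
rewrite inE; apply/andP; split; first by apply/set0Pn; exists p; rewrite set21.
apply/asboolP; apply: (@Morse_extension R K _ f).
- have sep a b : ~~ meet a b -> [/\ (val a).1 = (val b).1 -> a = b,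
      (val a).2 = (val b).2 -> a = b & (val a).1 != (val b).2].
    move=> /negP ab; have H x : incident x a -> incident x b -> False.
      by move=> xa xb; apply: ab; apply/meetP; exists x.
    split=> [E|E|]; try by exfalso; apply: (H _ (i1 a)); rewrite E.
      by exfalso; apply: (H _ (i2 a)); rewrite E.
    by apply/eqP => E; apply: (H _ (i1 a)); rewrite E.
  have qp : ~~ meet q p.
    by apply: contra pq => /meetP[x [xq xp]]; apply/meetP; exists x.
  by move=> a b /set2P[] -> /set2P[] ->; [|apply: sep|apply: sep|].
- by move=> a /set2P[] ->; [rewrite !fp | rewrite !fq].
- move=> a b aB bB ab; have := bB; rewrite !inE negb_or => /andP[bp bq].
  have bF := valP b; move: aB ab => /set2P[] -> ab.
  + rewrite -ab fp // /f; case: ifP => [b2p|_].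
      case/orP: b2p => /eqP E; last by case/eqP: bp; apply: primitive_eq.
      by have := irr b; rewrite -ab E eqxx.
    by case: ifP; rewrite ltr0n.
  + rewrite -ab fq // /f; case: ifP => [b2p|_].
      case/orP: b2p => /eqP E.
        by move: bF; rewrite -ab E (negbTE qp1).
      by move: bF; rewrite -ab E (negbTE qp2).
    case: ifP => [b2q|_]; last by rewrite ltr1n.
    case/orP: b2q => /eqP E; last by case/eqP: bq; apply: primitive_eq.
    by have := irr b; rewrite -ab E eqxx.
Qed.

(** Regular pairs of one function are disjoint. Conversely, [Morse_pair_aux] applies to disjoint
    pairs in one of the two orders: by dimensions, both orders fail only if each lower end is a
    facet of both upper ends, which [immediate_face_square] excludes. *)
Lemma Morse_pair p q : p != q ->
  ([set p; q] \in Morse_simplices R K) = ~~ meet p q.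
Proof.
move=> pq; apply/idP/idP => [|npq].
  rewrite inE => /andP[_ /asboolP[f fM E]].
  have [up dn] := (discrete_MorseP f).1 fM.
  have rp : regular_pair f (val p).1 (val p).2.
    by have := set21 p q; rewrite E inE.
  have rq : regular_pair f (val q).1 (val q).2.
    by have := set22 p q; rewrite E inE.
  apply: contra pq => /meetP[x []] /orP[] /eqP -> /orP[] /eqP H; apply/eqP.
  - by apply: primitive_eq => //; apply: up rp _; rewrite H.
  - by exfalso; apply: discrete_Morse_up_down fM rq _; rewrite -H; apply: rp.
  - by exfalso; apply: discrete_Morse_up_down fM rp _; rewrite H; apply: rq.
  - by apply: primitive_eq => //; apply: dn rp _; rewrite H.
have qnp : ~~ meet q p.
  by apply: contra npq => /meetP[x [xq xp]]; apply/meetP; exists x.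
have [H|qp2] := boolP (immediate_face (val q).1 (val p).2); last first.
  have [H|qp1] := boolP (immediate_face (val q).1 (val p).1);
    last exact: Morse_pair_aux.
  rewrite setUC; apply: Morse_pair_aux => //; apply/negP => /dim_face H2.
    have := dim_primitive q; have := dim_face H; lia.
  have := dim_face H; lia.
rewrite setUC; apply: Morse_pair_aux => //; apply/negP => H2.
  case/negP: npq; apply/meetP; exists (val p).2.
  suff E : (val q).2 = (val p).2 by rewrite /incident E !eqxx !orbT.
  apply: (immediate_face_square _ (valP q) H2 H (valP p)).
  apply: contra qnp => /eqP E; apply/meetP; exists (val p).1.
  by rewrite /incident -E !eqxx.
have := dim_face H; have := dim_face H2; have := dim_primitive p; lia.
Qed.

End Incidence.

Definition simplex_of (K : simplicial_complex) (x : {set vertex K})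
  (xK : x \in simplices K) : simplex K :=
  exist (fun y => y \in simplices K) x xK.

Definition primitive_of (K : simplicial_complex) (s t : simplex K)
  (st : immediate_face s t) : primitive K :=
  exist (fun p => immediate_face p.1 p.2) (s, t) st.

(** Removing a vertex of the lower end gives a second facet. So a simplex that lies in a single pair
    is the lower end of it. *)
Lemma card_star_upper (K : simplicial_complex) (p : primitive K) :
  1 < #|star (val p).2|.
Proof.
have /andP[] := valP p => pq _; have := valP p; rewrite immediate_faceE.
move=> /andP[_ /eqP c2].
have [b bp] := set0Pn _ (simplex_neq0 (valP (val p).1)).
have b2 : b \in val (val p).2 by apply: (subsetP pq).
have c1 := card_simplex_gt0 (val p).1.
have sK : val (val p).2 :\ b \in simplices K.
  apply: simplices_sub (valP (val p).2) (subsetDl _ _) _.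
  by rewrite -card_gt0; move: c2; rewrite (cardsD1 b) b2 add1n => -[->].
have F : immediate_face (simplex_of sK) (val p).2.
  rewrite immediate_faceE /= subsetDl (cardsD1 b (val (val p).2)) b2.
  by rewrite add1n eqxx.
apply/card_gt1P; exists p, (primitive_of F).
split; rewrite ?inE /incident ?eqxx ?orbT //.
apply/eqP => /(congr1 (fun r : primitive K => val (val r).1)) /= E.
by move: bp; rewrite /= E !inE eqxx.
Qed.

(* Distinct simplices with the same star would form an isolated edge of the
   Hasse diagram, but its upper end has another facet. *)
Lemma star_inj (K : simplicial_complex) (x y : simplex K) :
  star x != set0 -> star x = star y -> x = y.
Proof.
move=> /set0Pn[p px] E; have py : p \in star y by rewrite -E.
apply/eqP; apply: contraT => xy.
have : 1 < #|star x|.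
  move: px py xy; rewrite !inE => /orP[] /eqP Ex /orP[] /eqP Ey.
  - by rewrite Ex Ey eqxx.
  - by rewrite E Ey card_star_upper.
  - by rewrite Ex card_star_upper.
  - by rewrite Ex Ey eqxx.
move=> /card_gt1P[a [b [ax bx ab]]]; case/negP: xy; apply/eqP.
have ay : a \in star y by rewrite -E.
have by_ : b \in star y by rewrite -E.
move: ax bx ay by_; rewrite !inE => ax bx ay by_.
by apply: incident_uniq ab _ _ _ _.
Qed.

(** * Whitney's theorem: stars are mapped to stars *)

Section Whitney.
Variables (K L : simplicial_complex) (h : primitive K -> primitive L).
Hypothesis hI : injective h.
Hypothesis hm : forall p q, meet (h p) (h q) = meet p q.

(** The images of two pairs at [x] determine [y]; by [meet_triangle] the image of any third pair
    passes through [y] too. *)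
Lemma star_image_sub (x : simplex K) : 1 < #|star x| ->
  exists y : simplex L, h @: star x \subset star y.
Proof.
move=> /card_gt1P[p [q [px qx pq]]].
have mx a b : a \in star x -> b \in star x -> meet (h a) (h b).
  by rewrite hm !inE => ax bx; apply/meetP; exists x.
have /meetP[y [py qy]] := mx _ _ px qx.
have hpq : h p != h q by rewrite (inj_eq hI).
exists y; apply/subsetP => _ /imsetP[r rx ->]; rewrite inE.
have [->//|rp] := eqVneq r p; have [->//|rq] := eqVneq r q.
have [||z [pz qz rz]] := meet_triangle hpq _ _
  (mx _ _ px qx) (mx _ _ px rx) (mx _ _ qx rx).
- by rewrite (inj_eq hI) eq_sym.
- by rewrite (inj_eq hI) eq_sym.
by rewrite (incident_uniq hpq py qy pz qz).
Qed.

End Whitney.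

Section WhitneyBijection.
Variables (K L : simplicial_complex).
Variables (h : primitive K -> primitive L) (k : primitive L -> primitive K).
Hypotheses (hK : cancel h k) (kK : cancel k h).
Hypothesis hm : forall p q, meet (h p) (h q) = meet p q.

Let hI := can_inj hK.
Let kI := can_inj kK.
Let km p q : meet (k p) (k q) = meet p q.
Proof. by rewrite -hm !kK. Qed.

(** The inverse [k] takes the star of [y] into a star that contains the star of [x]; two common
    pairs force it to be the star of [x]. *)
Lemma star_image_big (x : simplex K) : 1 < #|star x| ->
  exists y : simplex L, star y = h @: star x.
Proof.
move=> x2; have [y xy] := star_image_sub hI hm x2.
have y2 : 1 < #|star y|.
  by apply: leq_trans x2 _; rewrite -(card_imset _ hI) subset_leq_card.
have [z yz] := star_image_sub kI km y2.
have hk (A : {set primitive L}) : A = h @: (k @: A).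
  by rewrite -imset_comp (eq_imset (g := id) _ kK) imset_id.
have xz : x = z.
  have /card_gt1P[p [q [px qx pq]]] := x2.
  have sub : star x \subset star z.
    apply: subset_trans yz; rewrite -[star x]imset_id -(eq_imset _ hK).
    rewrite imset_comp.
    exact: imsetS.
  have := subsetP sub _ px; have := subsetP sub _ qx.
  move: px qx; rewrite !inE => px qx qz pz.
  exact: incident_uniq pq px qx pz qz.
exists y; apply/eqP; rewrite eqEsubset xy andbT.
by rewrite (hk (star y)) imsetS // xz.
Qed.

End WhitneyBijection.

Section WhitneyStar.
Variables (K L : simplicial_complex).
Variables (h : primitive K -> primitive L) (k : primitive L -> primitive K).
Hypotheses (hK : cancel h k) (kK : cancel k h).
Hypothesis hm : forall p q, meet (h p) (h q) = meet p q.

(** If [p] is the only pair at [x], the upper end of [p] has a large star, mapped to that of one end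
    [y] of [h p]. The other end [y'] has no further pair: a large star at [y'] would come from an
    end of [p] other than [x], hence from the upper end, giving [y' = y]. *)
Lemma star_image (x : simplex K) : star x != set0 ->
  exists y : simplex L, star y = h @: star x.
Proof.
have km p q : meet (k p) (k q) = meet p q by rewrite -hm !kK.
move=> x0; have [/(star_image_big hK kK hm)//|] := ltnP 1 #|star x|.
rewrite leq_eqVlt ltnS leqn0 cards_eq0 (negbTE x0) orbF => /cards1P[p Ep].
have px : incident x p by have := set11 p; rewrite -Ep inE.
have xp : x = (val p).1.
  case/orP: px => /eqP // E; have := card_star_upper p.
  by rewrite -E Ep cards1.
have [y yE] := star_image_big hK kK hm (card_star_upper p).
have hpy : incident y (h p).
  suff : h p \in star y by rewrite inE.
  by rewrite yE imset_f // inE /incident eqxx orbT.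
have [y' [y'y hpy']] : exists y', y' != y /\ incident y' (h p).
  have d : (val (h p)).1 != (val (h p)).2.
    by apply: contra_eq_neq (dim_primitive (h p)) => ->; rewrite ltn_eqF.
  case/orP: hpy => /eqP ->.
    by exists (val (h p)).2; rewrite eq_sym d /incident eqxx orbT.
  by exists (val (h p)).1; rewrite d /incident eqxx.
exists y'; rewrite Ep imset_set1; apply/eqP.
rewrite eq_sym eqEcard sub1set inE hpy' cards1 leqNgt.
apply/negP => y'2; have [z zE] := star_image_big kK hK km y'2.
have pz : incident z p.
  suff : p \in star z by rewrite inE.
  by rewrite zE -[p]hK imset_f // inE.
have hk (A : {set primitive L}) : A = h @: (k @: A).
  by rewrite -imset_comp (eq_imset (g := id) _ kK) imset_id.
have zy : z = (val p).2.
  case/orP: pz => /eqP // E; move: y'2.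
  by rewrite -(card_imset _ (can_inj kK)) -zE E -xp Ep cards1.
case/eqP: y'y; apply: star_inj; first by rewrite -card_gt0 ltnW.
by rewrite yE -zy zE -hk.
Qed.

End WhitneyStar.

(** * From pairs and stars back to Hasse diagrams *)

Section HasseEdges.
Variable K : simplicial_complex.

Lemma adjacent_primitive (x y : simplex K) a : val y = flip a (val x) ->
  exists p, incident x p /\ incident y p.
Proof.
move=> E; have [ax|ax] := boolP (a \in val x).
  have F : immediate_face y x.
    rewrite immediate_faceE E flip_in // subsetDl (cardsD1 a (val x)) ax.
    by rewrite add1n eqxx.
  exists (primitive_of F).
  by rewrite /incident !eqxx orbT.
have F : immediate_face x y.
  by rewrite immediate_faceE E flip_notin // subsetUr cardsU1 ax eqxx.
exists (primitive_of F).
by rewrite /incident !eqxx orbT.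
Qed.

Lemma incident_flip (x y : simplex K) p : x != y ->
  incident x p -> incident y p -> exists a, val y = flip a (val x).
Proof.
have H (s t : simplex K) :
    immediate_face s t -> exists a, val t = flip a (val s).
  rewrite immediate_faceE => /andP[st /eqP c].
  have /cards1P[a D] : #|val t :\: val s| == 1.
    by rewrite cardsD (setIidPr st) c subSnn.
  have : a \in val t :\: val s by rewrite D set11.
  rewrite inE => /andP[as_ _]; exists a.
  by rewrite flip_notin // -D setUC -{1}(setIidPr st) setID.
move=> xy /orP[] /eqP Ex /orP[] /eqP Ey; move: xy; rewrite Ex Ey ?eqxx // => _.
  exact: H (valP p).
by have [a ->] := H _ _ (valP p); exists a; rewrite flipK.
Qed.

(** A simplex without neighbours has no facet, hence is a vertex, and lies on no edge. *)
Lemma star_eq0_card (x : simplex K) : connected_complex K -> star x = set0 ->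
  #|vertex K| = 1.
Proof.
move=> Kc x0; have no p : incident x p -> False.
  by move=> xp; have : p \in star x; [rewrite inE | rewrite x0 inE].
have noflip (y : {set vertex K}) a :
    y \in simplices K -> y = flip a (val x) -> False.
  move=> yK E; have [p []] := @adjacent_primitive x (simplex_of yK) a E.
  by move/no.
have [v vx] := set0Pn _ (simplex_neq0 (valP x)).
have xv : val x = [set v].
  have [x1|] := eqVneq (val x :\ v) set0;
    first by rewrite -(setD1K vx) x1 setU0.
  move=> ne; exfalso; apply: (noflip (val x :\ v) v); last by rewrite flip_in.
  exact: simplices_sub (valP x) (subsetDl _ _) ne.
have : [set v] = setT.
  apply: (connected_closed (u := v)) => //; first exact: set11.
  move=> a w /set1P -> vw vwK; exfalso; apply: (noflip _ w vwK).
  by rewrite xv flip_notin ?inE 1?eq_sym // setUC.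
by move/(congr1 (fun A : {set _} => #|A|)); rewrite cards1 cardsT.
Qed.

Lemma primitive_card (p : primitive K) : 1 < #|vertex K|.
Proof.
have := valP p; rewrite immediate_faceE => /andP[_ /eqP c].
have := card_simplex_gt0 (val p).1; rewrite -ltnS -c => /leq_trans; apply.
exact: max_card.
Qed.

End HasseEdges.

(** Nonempty stars determine their simplices, so [h] and [k] induce inverse bijections of simplices.
    These preserve adjacency, because the ends of [p] go to the ends of [h p]. *)
Lemma bijection_hasse K L (h : primitive K -> primitive L) k :
  cancel h k -> cancel k h -> (forall p q, meet (h p) (h q) = meet p q) ->
  (forall x : simplex K, star x != set0) ->
  (forall y : simplex L, star y != set0) ->
  exists F G, @hasse_iso K L F G.
Proof.
move=> hK kK hm K0 L0.
have km p q : meet (k p) (k q) = meet p q by rewrite -hm !kK.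
have /fin_all_exists[f fE] x := star_image hK kK hm (K0 x).
have /fin_all_exists[g gE] y := star_image kK hK km (L0 y).
have kh (A : {set primitive K}) : k @: (h @: A) = A.
  by rewrite -imset_comp (eq_imset (g := id) _ hK) imset_id.
have hk (A : {set primitive L}) : h @: (k @: A) = A.
  by rewrite -imset_comp (eq_imset (g := id) _ kK) imset_id.
have fK : cancel f g by move=> x; apply: star_inj; rewrite ?K0 // gE fE kh.
have gK : cancel g f by move=> y; apply: star_inj; rewrite ?L0 // fE gE hk.
pose ext (M N : simplicial_complex) (u : simplex M -> simplex N)
    (x : {set vertex M}) :=
  if insub x is Some s then val (u s) else set0.
have extE (M N : simplicial_complex) (u : simplex M -> simplex N) s :
  ext M N u (val s) = val (u s) by rewrite /ext valK.
have lift (M : simplicial_complex) (x : {set vertex M}) : x \in simplices M ->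
  exists s : simplex M, x = val s by move=> xM; exists (simplex_of xM).
have adj (M N : simplicial_complex) (u : simplex M -> simplex N) j :
    injective u -> (forall x, star (u x) = j @: star x) ->
    forall x a, x \in simplices M -> flip a x \in simplices M ->
    exists b, ext M N u (flip a x) = flip b (ext M N u x).
  move=> uI uE x a /lift[s Es] /lift[t Et].
  have st : val t = flip a (val s) by rewrite -Et Es.
  have [p [sp tp]] := adjacent_primitive st.
  rewrite Et Es !extE; apply: (@incident_flip _ _ _ (j p)).
  - rewrite (inj_eq uI); apply: contra_not_neq (@flip_neq _ a x) => E.
    by rewrite Et -E -Es.
  - suff : j p \in star (u s) by rewrite inE.
    by rewrite uE imset_f // inE.
  - suff : j p \in star (u t) by rewrite inE.
    by rewrite uE imset_f // inE.
exists (ext _ _ f), (ext _ _ g); split.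
- by move=> _ /lift[s ->]; rewrite extE; apply: valP.
- by move=> _ /lift[s ->]; rewrite extE; apply: valP.
- by move=> _ /lift[s ->]; rewrite !extE fK.
- by move=> _ /lift[s ->]; rewrite !extE gK.
- exact: adj (can_inj fK) fE.
- exact: adj (can_inj gK) gE.
Qed.

Lemma point_isomorphic K L : #|vertex K| = 1 -> #|vertex L| = 1 ->
  isomorphic K L.
Proof.
move=> K1 L1; have [f fb] := card_bijection (etrans K1 (esym L1)).
have H (M : simplicial_complex) : #|vertex M| = 1 ->
    forall x : {set vertex M}, (x \in simplices M) = (x != set0).
  move=> M1 x; apply/idP/idP => [|x0]; first exact: simplex_neq0.
  suff /cards1P[v ->] : #|x| == 1 by apply: simplices_set1.
  by rewrite eqn_leq card_gt0 x0 -M1 max_card.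
by exists f => // s; rewrite !H // imset_eq0.
Qed.

Lemma Morse_meet (R : realType) K L (h : primitive K -> primitive L) :
  injective h ->
  (forall A : {set primitive K},
    (h @: A \in Morse_simplices R L) = (A \in Morse_simplices R K)) ->
  forall p q, meet (h p) (h q) = meet p q.
Proof.
move=> hI hA p q; have [->|pq] := eqVneq p q.
  have refl (M : simplicial_complex) (r : primitive M) : meet r r.
    by apply/meetP; exists (val r).1; rewrite /incident eqxx.
  by rewrite !refl.
apply: negb_inj; rewrite -!(Morse_pair R) ?(inj_eq hI) // -hA.
by rewrite imsetU1 imset_set1.
Qed.

Theorem theoremA (R : realType) (K L : simplicial_complex)
    (Kconn : connected_complex K) (Lconn : connected_complex L)
    (isoM : isomorphic (Morse_complex R K) (Morse_complex R L)) :
  isomorphic K L.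
Proof.
have [h hb hA] := isoM.
have hm := Morse_meet (bij_inj hb) hA.
have [k hK kK] := hb.
(* An empty star makes [K] a point, which has no pairs; then [L] has no pairs either and is a point.
   The same is done with [L] in place of [K]. *)
have [/existsP[x /eqP x0]|/existsPn K0] :=
  boolP [exists x : simplex K, star x == set0].
  have K1 := star_eq0_card Kconn x0; apply: point_isomorphic => //.
  have /card_gt0P[z _] := Lconn.1.
  apply: (star_eq0_card (x := simplex_of (simplices_set1 z))) => //.
  apply/eqP; rewrite -subset0; apply/subsetP => p _.
  by have := primitive_card (k p); rewrite K1.
have [/existsP[y /eqP y0]|/existsPn L0] :=
  boolP [exists y : simplex L, star y == set0].
  have L1 := star_eq0_card Lconn y0; apply: point_isomorphic => //.
  have /card_gt0P[z _] := Kconn.1.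
  apply: (star_eq0_card (x := simplex_of (simplices_set1 z))) => //.
  apply/eqP; rewrite -subset0; apply/subsetP => p _.
  by have := primitive_card (h p); rewrite L1.
have [F [G FG]] := bijection_hasse hK kK hm K0 L0.
exact: hasse_isomorphic Kconn Lconn FG.
Qed.
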